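(* The number $R_3(L)$ satisfies $R_3(L) \leq 1804$.
   Context: For a positive integer $n$, the $n \times n$ integer grid is $[n]\times[n]=\{(i,j): 1\le i,j\le n\}$, where $(i,j)$ is the point in row $i$ (rows counted downward) and column $j$ (columns counted left to right). Given a coloring of $[n]\times[n]$ with $k$ colors (an arbitrary map from $[n]\times[n]$ to a set of $k$ colors), a monochromatic $L$ is a set of three points $\{(x,y),(x+d,y),(x+d,y+d)\}\subseteq [n]\times[n]$, with $d$ a positive integer, all having the same color. For a positive integer $k$, $R_k(L)$ denotes the least positive integer $n$ such that every $k$-coloring of $[n]\times[n]$ contains a monochromatic $L$ (it exists by the Gallai-Witt theorem). *)

(* Defs.v *)
From mathcomp Require Import all_boot.

Set Implicit Arguments.
Unset Strict Implicit.
Unset Printing Implicit Defensive.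

(* The grid [n] x [n] is indexed from 0, i.e. by 'I_n * 'I_n, as (row, column);
   this does not matter since L's are translation invariant. *)
Definition coloring (k n : nat) := 'I_n * 'I_n -> 'I_k.

Definition monochromatic_L (k n : nat) (c : coloring k n) : Prop :=
  exists (x y x' y' : 'I_n) (d : nat),
    [/\ 0 < d, x' = x + d :> nat, y' = y + d :> nat,
        c (x', y) = c (x, y) & c (x', y') = c (x, y)].

Definition forces_L (k n : nat) : Prop :=
  forall c : coloring k n, monochromatic_L c.

(* r = R_k(L).  The number is given by its graph, which contains at most one r
   for each k, so that no default value is needed when no such n exists. *)
Definition is_RL (k r : nat) : Prop :=
  [/\ 0 < r, forces_L k r & forall n, 0 < n -> forces_L k n -> r <= n].

(* Main.v *)
(* Suppose there is no monochromatic L.  Let r be the majority color on the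
   diagonal and h the most frequent difference of r-colored diagonal points.
   The points (u + h, u) with (u, u) and (u + h, u + h) colored r avoid r, so
   the set U of those u for which (u + h, u) has a fixed color b can be chosen
   to contain about n / 36 elements.  For u < v in U the point (v + h, u) can
   have neither color r nor b, hence it has the third color, and since there is
   no L all differences of elements of U are distinct.  The Erdos-Turan window
   count for Sidon sets bounds #|U| by about sqrt n + n^(1/4) + 1. *)

Require Import Defs.
From mathcomp Require Import all_boot.
From mathcomp Require Import zify.

Set Implicit Arguments.
Unset Strict Implicit.
Unset Printing Implicit Defensive.

(** * Pigeonhole principle and counting of pairs *)

Lemma pigeonhole (T T' : finType) (f : T -> T') (A : {set T}) (B : {set T'})
    (p : nat) :
  {in A, forall x, f x \in B} -> #|B| * p < #|A| ->
  exists2 y, y \in B & p < #|[set x in A | f x == y]|.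
Proof.
move=> fAB; rewrite ltnNge => ltBA; apply/exists_inP.
apply: contraNT ltBA; rewrite negb_exists_in => /forall_inP small.
rewrite -sum1_card (partition_big f (mem B)) //= -sum_nat_const.
apply: leq_sum => y By; have := small y By; rewrite -leqNgt.
by rewrite -sum1_card; congr (_ <= _); apply: eq_bigl => x; rewrite inE.
Qed.

Definition lt_pairs (n : nat) (A : {set 'I_n}) : {set 'I_n * 'I_n} :=
  [set z in setX A A | z.1 < z.2].

Lemma lt_pairsP (n : nat) (A : {set 'I_n}) (z : 'I_n * 'I_n) :
  reflect [/\ z.1 \in A, z.2 \in A & z.1 < z.2] (z \in lt_pairs A).
Proof. by rewrite !inE -andbA; apply: and3P. Qed.

Lemma card_lt_pairs (n : nat) (A : {set 'I_n}) :
  #|A| * #|A| = #|A| + 2 * #|lt_pairs A|.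
Proof.
rewrite -cardsX -(cardsID [set z : 'I_n * 'I_n | z.1 == z.2]).
congr (_ + _).
  have <- : [set (x, x) | x in A] = setX A A :&: [set z | z.1 == z.2].
    apply/setP => -[x y]; rewrite !inE /=; apply/imsetP/idP.
      by case=> i Ai [-> ->]; rewrite Ai eqxx.
    by case/andP=> /andP[Ax _] /eqP <-; exists x.
  by rewrite card_imset // => x y [].
rewrite -(cardsID [set z : 'I_n * 'I_n | z.1 < z.2]) mul2n -addnn.
congr (_ + _).
  apply: eq_card => -[x y]; rewrite !inE /= -val_eqE /=.
  by case: ltngtP; rewrite ?andbF ?andbT.
pose swap (z : 'I_n * 'I_n) := (z.2, z.1).
have swapI : injective swap by case=> [x y] [x' y'] [-> ->].
rewrite -(card_imset (lt_pairs A) swapI).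
apply: eq_card => -[x y]; rewrite !inE /= -val_eqE /=.
apply/idP/imsetP.
  case/and3P=> nlt ne /andP[Ax Ay]; exists (y, x) => //.
  by apply/lt_pairsP; split=> //=; lia.
case=> -[x' y'] /lt_pairsP[/= Ax Ay lt] [-> ->]; rewrite Ax Ay !andbT; lia.
Qed.

(** * Sidon sets and window counts *)

Definition sidon (n : nat) (A : {set 'I_n}) : Prop :=
  {in lt_pairs A &, injective (fun z : 'I_n * 'I_n => z.2 - z.1)}.

(** Here [t] is the right end, so that as [t] runs below [n + w] every point, even near the border,
    lies in exactly [w] windows. *)
Definition window (n w t : nat) : {set 'I_n} := [set u : 'I_n | u <= t < u + w].

Lemma sum_window (N a b : nat) : b <= N -> \sum_(t < N) (a <= t < b) = b - a.
Proof.
move=> leN; rewrite -big_mkcond /=.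
rewrite -(big_mkord (fun t => a <= t < b) (fun=> 1)).
case: (leqP a b) => [leab|ltba]; last first.
  by rewrite big1 => [|i]; lia.
rewrite (big_cat_nat (n := b)) //= (big_cat_nat (n := a)) //=.
rewrite big_nat_cond big1 ?add0n => [|i]; last lia.
rewrite addnC big_nat_cond big1 ?add0n => [|i]; last lia.
rewrite big_nat_cond.
rewrite (eq_bigl (fun i => (a <= i < b) && true)) => [|i]; last lia.
by rewrite -big_nat_cond sum_nat_const_nat muln1.
Qed.

(** Subtraction is truncated: the second term makes up for the summands missing when [n < w], and
    vanishes otherwise. *)
Lemma triangular_sum (w n : nat) :
  2 * (\sum_(1 <= d < n.+1) (w - d)) + (w - n) * (w - n).-1 = w * w.-1.
Proof.
elim: n => [|n IHn]; first by rewrite big_geq ?subn0.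
by rewrite big_nat_recr //= -IHn; case: (w - n) (subnS w n) => [|k] ->; nia.
Qed.

(* Double counting of the points, and of the pairs of points, of A in the
   n + w windows of length w: distinct differences make the latter small. *)
Lemma sidon_card (n w a : nat) (A : {set 'I_n}) :
  sidon A -> 2 * a * (w * #|A|) <= w * w.-1 + (n + w) * (a * a.+1).
Proof.
move=> sidA.
pose W t := A :&: window n w t.
have points : \sum_(t < n + w) #|W t| = w * #|A|.
  rewrite mulnC -sum_nat_const.
  transitivity (\sum_(t < n + w) \sum_(u : 'I_n) (u \in W t)).
    by apply: eq_bigr => t _; rewrite -sum1_card big_mkcond.
  rewrite exchange_big [RHS]big_mkcond; apply: eq_bigr => u _ /=.
  case: (boolP (u \in A)) => Au; last first.
    by rewrite big1 // => t _; rewrite inE (negbTE Au).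
  rewrite -[RHS](addKn u) -(@sum_window (n + w)).
    by apply: eq_bigr => t _; rewrite !inE Au.
  by rewrite leq_add2r ltnW.
have pairs : \sum_(t < n + w) #|lt_pairs (W t)|
             = \sum_(z in lt_pairs A) (w - (z.2 - z.1)).
  transitivity (\sum_(t < n + w) \sum_(z : 'I_n * 'I_n)
                  (z \in lt_pairs (W t))).
    by apply: eq_bigr => t _; rewrite -sum1_card big_mkcond.
  rewrite exchange_big [RHS]big_mkcond; apply: eq_bigr => -[u v] _ /=.
  case: (lt_pairsP A) => [[/= Au Av ltuv]|notA]; last first.
    rewrite big1 // => t _; case: lt_pairsP => // -[/= Wu Wv ltuv].
    by case: notA; case/setIP: Wu => Au _; case/setIP: Wv => Av _.
  (* Both points lie in window [t] exactly when [v <= t < u + w]. *)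
  transitivity (u + w - v); last lia.
  rewrite -(@sum_window (n + w)) ?leq_add2r ?(ltnW (ltn_ord u)) //.
  apply: eq_bigr => t _; rewrite !inE /= Au Av ltuv /=.
  by congr nat_of_bool; lia.
have few : 2 * \sum_(z in lt_pairs A) (w - (z.2 - z.1)) <= w * w.-1.
  pose diff (z : 'I_n * 'I_n) : 'I_n :=
    Ordinal (leq_ltn_trans (leq_subr z.1 z.2) (ltn_ord z.2)).
  have injd : {in lt_pairs A &, injective diff}.
    by move=> z z' Az Az' /(congr1 val); apply: sidA.
  rewrite -(big_imset (fun d : 'I_n => w - d) injd) /=.
  (* The differences are positive and distinct, so each weight [w - d] with [0 < d < n] occurs at
     most once. *)
  have le1 : \sum_(d in diff @: lt_pairs A) (w - d)
             <= \sum_(d < n | 0 < d) (w - d).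
    rewrite [leqRHS](bigID (mem (diff @: lt_pairs A))) /=.
    apply: leq_trans (leq_addr _ _); rewrite eq_leq //; apply: eq_bigl => d.
    case: (boolP (d \in _)) => [/imsetP[z /lt_pairsP[_ _ lt] ->]|]; last first.
      by rewrite andbF.
    by rewrite /= andbT subn_gt0 lt.
  apply: leq_trans (leq_mul (leqnn 2) le1) _.
  have -> : \sum_(d < n | 0 < d) (w - d) = \sum_(1 <= d < n) (w - d).
    by rewrite -(big_mkord (fun d => 0 < d)) [RHS](@big_nat_widenl _ _ _ _ 0).
  case: (n) => [|m]; first by rewrite big_geq.
  by rewrite -(triangular_sum w m) leq_addr.
(* With [k] points in the window there are k(k - 1)/2 pairs, so this is (k - a)(k - a - 1) >= 0,
   true for integers. *)
have convex t : 2 * a * #|W t| <= 2 * #|lt_pairs (W t)| + a * a.+1.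
  have := card_lt_pairs (W t); move: #|W t| #|lt_pairs (W t)| => k P.
  by case: (leqP k a) => [/subnKC <-|/subnKC <-]; nia.
rewrite -points big_distrr /=.
apply: (@leq_trans (\sum_(t < n + w) (2 * #|lt_pairs (W t)| + a * a.+1))).
  by apply: leq_sum => t _; apply: convex.
by rewrite big_split /= -big_distrr /= pairs sum_nat_const card_ord leq_add2r.
Qed.

(** * Decidability and the least grid size *)

Definition has_L (k n : nat) (c : coloring k n) : bool :=
  [exists x : 'I_n, exists y : 'I_n, exists x' : 'I_n, exists y' : 'I_n,
    [&& x < x', x' + y == x + y', c (x', y) == c (x, y) &
        c (x', y') == c (x, y)]].

Lemma has_LP (k n : nat) (c : coloring k n) :
  reflect (monochromatic_L c) (has_L c).
Proof.
apply: (iffP idP) => [/existsP[x /existsP[y /existsP[x' /existsP[y']]]]|].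
  case/and4P=> ltx /eqP eqd /eqP c1 /eqP c2.
  by exists x, y, x', y', (x' - x); split=> //; lia.
case=> x [y [x' [y' [d [d0 ex ey c1 c2]]]]].
apply/existsP; exists x; apply/existsP; exists y.
apply/existsP; exists x'; apply/existsP; exists y'.
by rewrite c1 c2 !eqxx !andbT; lia.
Qed.

(** Passing to finite functions makes the property decidable, so that a least [n] can be chosen. *)
Lemma forces_LP (k n : nat) :
  reflect (forces_L k n) [forall c : {ffun 'I_n * 'I_n -> 'I_k}, has_L c].
Proof.
apply: (iffP forallP) => [allL c|allL c]; last exact/has_LP/allL.
have /has_LP := allL (finfun c).
case=> x [y [x' [y' [d [d0 ex ey c1 c2]]]]].
by exists x, y, x', y', d; split; rewrite // !ffunE in c1 c2 *.
Qed.

Lemma is_RL_exists (k n : nat) :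
  0 < n -> forces_L k n -> exists r, is_RL k r /\ r <= n.
Proof.
move=> n0 Fn.
pose P m := (0 < m) && [forall c : {ffun 'I_m * 'I_m -> 'I_k}, has_L c].
have exP : exists m, P m by exists n; rewrite /P n0; apply/forces_LP.
case: (ex_minnP exP) => r /andP[r0 /forces_LP Fr] min_r.
have least m : 0 < m -> forces_L k m -> r <= m.
  by move=> m0 Fm; apply: min_r; rewrite /P m0; apply/forces_LP.
by exists r; split; [split | apply: least].
Qed.

(** * Colorings without an L *)

Lemma ord3_third (r b g g' : 'I_3) :
  b != r -> g != r -> g != b -> g' != r -> g' != b -> g = g'.
Proof.
rewrite -!val_eqE /= => *; apply: val_inj => /=.
by move: (ltn_ord r) (ltn_ord b) (ltn_ord g) (ltn_ord g'); lia.
Qed.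

Lemma noL_corner (k n : nat) (c : coloring k n) (x y x' y' : 'I_n) :
  ~ monochromatic_L c -> x < x' -> x' + y = x + y' -> c (x', y') = c (x, y) ->
  c (x', y) != c (x, y).
Proof.
move=> noL ltx eqd c2; apply/eqP => c1; apply: noL.
by exists x, y, x', y', (x' - x); split=> //; lia.
Qed.

(* If u < v are in U then (u, u) and (v + h, v + h) on the one hand, (u + h, u)
   and (v + h, v) on the other hand, force the third color at (v + h, u); so a
   repeated difference in U produces an L of that color. *)
Lemma noL_sidon (n : nat) (c : coloring 3 n) (U : {set 'I_n}) (h : nat)
    (r b : 'I_3) :
    ~ monochromatic_L c -> b != r ->
    {in U, forall u : 'I_n, exists2 v : 'I_n, v = u + h :> nat &
       [/\ c (u, u) = r, c (v, v) = r & c (v, u) = b]} ->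
  sidon U.
Proof.
move=> noL br UP.
have corner (u v v' : 'I_n) :
    u \in U -> v \in U -> u < v -> v' = v + h :> nat ->
    c (v', u) != r /\ c (v', u) != b.
  move=> /UP[u1 eu [ru _ bu]] /UP[v1 ev [_ rv bv]] ltuv ev'.
  have ->: v' = v1 by apply: val_inj; rewrite /= ev ev'.
  split.
    by rewrite -ru; apply: (noL_corner noL (y' := v1)); rewrite ?ru //; lia.
  by rewrite -bu; apply: (noL_corner noL (y' := v)); rewrite ?bu //; lia.
(* If [u < s], then [(v + h, u)], [(t + h, u)] and [(t + h, s)] form an L of the third color with
   side [s - u = t - v]. *)
have no_lt (u v s t : 'I_n) : u \in U -> v \in U -> s \in U -> t \in U ->
    u < v -> s < t -> v - u = t - s -> s <= u.
  move=> Uu Uv Us Ut ltuv ltst eqd; rewrite leqNgt; apply/negP => ltus.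
  have [[v1 ev _] [t1 et _]] := (UP v Uv, UP t Ut).
  have [uvr uvb] := corner u v v1 Uu Uv ltuv ev.
  have [str stb] := corner s t t1 Us Ut ltst et.
  have [utr utb] := corner u t t1 Uu Ut (ltn_trans ltus ltst) et.
  have/eqP : c (t1, u) = c (v1, u) by apply: (@ord3_third r b).
  apply/negP; apply: (noL_corner noL (y' := s)); [lia|lia|].
  exact: (@ord3_third r b).
case=> [u v] [s t] /lt_pairsP[/= Uu Uv ltuv] /lt_pairsP[/= Us Ut ltst] eqd.
have leus := no_lt s t u v Us Ut Uu Uv ltst ltuv (esym eqd).
have lesu := no_lt u v s t Uu Uv Us Ut ltuv ltst eqd.
by congr (_, _); apply: val_inj => /=; lia.
Qed.

(** Three pigeonholes: more than [p] diagonal points share a color, more than [q] of their pairs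
    share one of the [n] positive differences, and more than [s] of the corners of these share one
    of the two other colors. The last hypothesis then contradicts [sidon_card]. *)
Lemma forces_L3 (n p q s w a : nat) :
    3 * p < n.+1 -> n * q * 2 < p.+1 * p -> 2 * s <= q ->
    w * w.-1 + (n.+1 + w) * (a * a.+1) < 2 * a * (w * s.+1) ->
  forces_L 3 n.+1.
Proof.
move=> lt_p lt_q lt_s lt_w c; apply/has_LP; apply: wlog_neg => /has_LP noL.
have [|r _ ltS] := @pigeonhole _ _ (fun i => c (i, i)) [set: 'I_n.+1] setT p
  (in1W (fun=> in_setT _)); first by rewrite !cardsT !card_ord.
set S := [set i in _ | _] in ltS.
have SP i : i \in S -> c (i, i) = r by rewrite !inE => /eqP.
pose diff (z : 'I_n.+1 * 'I_n.+1) : 'I_n.+1 := inord (z.2 - z.1).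
have diffE z : diff z = z.2 - z.1 :> nat.
  by rewrite inordK // (leq_ltn_trans (leq_subr _ _)).
have [z||h _ ltT] := @pigeonhole _ _ diff (lt_pairs S) [set~ ord0] q.
- case/lt_pairsP=> _ _ lt.
  by rewrite !inE -(inj_eq val_inj) /= diffE -lt0n subn_gt0.
- rewrite cardsC1 card_ord /=; move: (card_lt_pairs S) ltS lt_q.
  by move: #|S| #|lt_pairs S| (n * q) => k P m; clear; nia.
set T := [set z in _ | _] in ltT.
have TP (z : 'I_n.+1 * 'I_n.+1) : z \in T ->
    [/\ c (z.1, z.1) = r, c (z.2, z.2) = r, z.1 < z.2 & z.2 = z.1 + h :> nat].
  rewrite inE => /andP[/lt_pairsP[/SP ? /SP ? lt] /eqP eqh]; split=> //.
  by rewrite -eqh diffE subnKC // ltnW.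
have [z Tz||b] := @pigeonhole _ _ (fun z => c (z.2, z.1)) T [set~ r] s.
- have [r1 r2 lt _] := TP z Tz; rewrite !inE -r1.
  by apply: (noL_corner noL (y' := z.2)); [|rewrite addnC|rewrite r1].
- by rewrite cardsC1 card_ord /=; apply: leq_ltn_trans ltT.
rewrite !inE => br; set V := [set z in _ | _] => ltV.
have VP (z : 'I_n.+1 * 'I_n.+1) : z \in V ->
    z.2 = z.1 + h :> nat /\
    [/\ c (z.1, z.1) = r, c (z.2, z.2) = r & c (z.2, z.1) = b].
  by rewrite inE => /andP[/TP[? ? ? ?] /eqP ?].
have sidV : sidon [set z.1 | z in V].
  apply: (noL_sidon noL br (h := h)) => _ /imsetP[z /VP[eqh col] ->].
  by exists z.2.
have := sidon_card w a sidV.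
(* Pairs in [V] have difference [h], so the first entry determines the pair. *)
rewrite card_in_imset => [|[x y] [x' y'] /VP[/= e _] /VP[/= e' _] exx'].
  by have : w * s.+1 <= w * #|V|; [rewrite leq_mul2l ltV orbT | nia].
by rewrite -exx'; congr (_, _); apply: val_inj; rewrite /= e e' exx'.
Qed.

Theorem theorem3 : exists r : nat, is_RL 3 r /\ r <= 1804.
Proof.
apply: is_RL_exists => //.
(* 602 of 1804 diagonal points share a color; their 180901 pairs have at most
   1803 differences, so one difference occurs 101 times; 51 of these agree.
   Windows of length 300 then contain about 7 of the 51 points on average. *)
by apply: (@forces_L3 1803 601 100 50 300 7); lia.
Qed.
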